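(* For every integer $n\geq 5$, $$2^{n-3}-1\leq L(n)\leq 2^n-n-1.$$ Consequently, $L(n)=\Theta(2^n)$. Moreover, for every $n\geq 6$, the lower bound can be realized by a loopless Pulse Graph with maximum in-degree at most five and at most $5n-15$ directed edges; that is, there is a Pulse Graph on $n$ vertices with maximum in-degree at most $5$ and at most $5n-15$ directed edges that has an attractor of period $2^{n-3}-1$.
   Context: A Pulse Graph is a finite directed graph $G=(V,E)$ with no self-loops (for distinct $u,v$, each of the edges $(u,v)$, $(v,u)$ may or may not be present, with no multiple edges), together with Boolean states $x_t:V\to\{0,1\}$, $t=0,1,2,\dots$. For $v\in V$ let $N^-(v)=\{u\in V:(u,v)\in E\}$ and $k_t(v)=\sum_{u\in N^-(v)}x_t(u)$. All vertices are updated synchronously by: $x_{t+1}(v)=1$ if $k_t(v)$ is a prime number, and $x_{t+1}(v)=0$ otherwise. An attractor of period $p$ is a periodic sequence (periodic orbit) of this update consisting of $p$ distinct states; a fixed point is an attractor of period $1$. $L(n)$ denotes the maximum attractor period among all labeled directed loopless Pulse Graphs on $n$ vertices. *)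

(* Defs.v *)
From mathcomp Require Import all_boot.

Set Implicit Arguments.
Unset Strict Implicit.
Unset Printing Implicit Defensive.

(* A directed graph without multiple edges is its set of edges (u, v). *)
Notation digraph V := {set V * V}.

Notation state V := {ffun V -> bool}.

Section PulseGraph.

Variable V : finType.
Implicit Types (E : digraph V) (x : state V) (v : V) (p : nat).

Definition loopless E : bool := [forall v, (v, v) \notin E].

Definition in_nbrs E v : {set V} := [set u | (u, v) \in E].

Definition max_indegree E : nat := \max_(v : V) #|in_nbrs E v|.

Definition active_in E x v : nat := \sum_(u in in_nbrs E v) x u.

Definition pulse_step E x : state V := [ffun v => prime (active_in E x v)].

(* [ucycleb (frel f) c]: the entries of [c] are pairwise distinct and [f] maps each
   entry to the next one, the last one being mapped back to the first. The
   condition [0 < p] discards the empty cycle. *)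
Definition has_attractor E p : bool :=
  (0 < p) && [exists c : p.-tuple (state V), ucycleb (frel (pulse_step E)) c].

Lemma has_attractor_leq E p : has_attractor E p -> p <= 2 ^ #|V|.
Proof.
case/andP=> _ /existsP[c /andP[_ /card_uniqP]].
by rewrite size_tuple => <-; rewrite (leq_trans (max_card _)) // card_ffun card_bool.
Qed.

End PulseGraph.

Definition attractor_period (n p : nat) : bool :=
  [exists E : digraph 'I_n, loopless E && has_attractor E p].

(* Bounding the range of [p] by the number of states loses no period: see
   [L_max] below. *)
Definition L (n : nat) : nat := \max_(p < (2 ^ n).+1 | attractor_period n p) p.

Lemma L_max n p : attractor_period n p -> p <= L n.
Proof.
move=> np; have lt_p : p < (2 ^ n).+1.
  by case/existsP: np => E /andP[_ /has_attractor_leq]; rewrite card_ord.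
exact: (@leq_bigmax_cond _ (fun p : 'I_(2 ^ n).+1 => attractor_period n p)
  (fun p => p : nat) (Ordinal lt_p)).
Qed.

Lemma L_attained n : attractor_period n (L n).
Proof.
have L1 : attractor_period n 1.
  apply/existsP; exists set0; apply/andP; split.
    by apply/forallP=> v; rewrite inE.
  apply/andP; split=> //; apply/existsP; exists [tuple [ffun=> false]].
  rewrite /ucycleb /= !andbT; apply/eqP/ffunP=> v; rewrite !ffunE.
  by rewrite /active_in big1 // => u _; rewrite ffunE.
have lt1 : 1 < (2 ^ n).+1 by rewrite ltnS expn_gt0.
have [|p np Lp] := @eq_bigmax_cond _
    [pred p : 'I_(2 ^ n).+1 | attractor_period n p] (fun p => p : nat).
  by apply/card_gt0P; exists (Ordinal lt1).
by have -> : L n = p by rewrite -Lp.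
Qed.

(* Main.v *)
Require Import Defs.
From mathcomp Require Import all_boot all_order all_algebra.
From mathcomp Require Import all_classical reals topology normedtype landau.
From mathcomp Require Import cyclic finfield zify.

(** Upper bound. The zero state is fixed, and a state with a single active vertex is
    mapped to it, since no vertex then counts 2 or more. An attractor of period
    greater than 1 therefore avoids these [n + 1] states ([attractor_period_bound]).

    Lower bound. Let [m = n - 3]. Three vertices joined in all directions keep each
    other active, and serve as constants ([add_ones]). With them the primality
    rule computes linear algebra over the field with two elements: one bit plus 1 is
    prime iff the bit is 1, and two bits plus 3 is prime iff the bits are equal. The
    other [m] vertices can thus run a Galois shift register, that is,
    multiplication by an element [a] of the field with [2 ^ m] elements written in
    the basis of the powers of [a], up to a translation which is absorbed by
    moving the origin to the fixed point of the resulting affine map. If [a]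
    generates the multiplicative group, all states but this fixed point form a
    single cycle of length [2 ^ m - 1] ([register_attractor]). The in-degrees are
    2 for a copy and 5 for a sum, which gives the bounds on the number of edges.

    The register has no self-loop exactly when its last bit is not a tap, which
    means that [a] has trace zero. So a generator of trace zero is needed
    ([trace_zero_primitive]), and one exists as soon as [m > 2]. Indeed,
    suppose that all generators have trace one, and let [N = 2 ^ m - 1]. For a
    prime [l] dividing [N], the traces over a coset of the [l]-th roots of unity sum
    to zero, and [l] is odd. This excludes [l ^ 2] from dividing [N], and then
    shows, by induction, that all non-generators have trace zero
    ([trace_prim_pow]). If [N] is composite, the powers of some element [c] of large
    order then all have trace zero, which is impossible, because [c] has [m]
    distinct conjugates, whose power sums cannot all vanish ([group_order_prime]).
    If [N] is prime, all elements but 0 and 1 are generators, and the trace would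
    not be additive ([not_all_primitive_trace1]).

    For [n = 5] the field has four elements and its generators have trace one; a
    cycle of length 4 on two bits, one copied and one negated, does instead
    ([L_five]). *)

Set Implicit Arguments.
Unset Strict Implicit.
Unset Printing Implicit Defensive.

Import GRing.Theory.

(** * Generators of trace zero in fields of characteristic two *)

Local Open Scope ring_scope.

Section Trace.

Variables (F : finFieldType) (m : nat).
Hypotheses (char2 : 2%N \in [pchar F]) (cardF : #|F| = (2 ^ m)%N).

Definition trace (x : F) : F := \sum_(i < m) x ^+ (2 ^ i).

Lemma frobenius_iterD i (x y : F) :
  (x + y) ^+ (2 ^ i) = x ^+ (2 ^ i) + y ^+ (2 ^ i).
Proof. by apply: exprDn_pchar; rewrite pnatX pnatE ?char2. Qed.

Lemma traceD x y : trace (x + y) = trace x + trace y.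
Proof. by rewrite -big_split; apply: eq_bigr => i _; rewrite frobenius_iterD. Qed.

Lemma trace0 : trace 0 = 0.
Proof. by apply: (addIr (trace 0)); rewrite add0r -traceD addr0. Qed.

Lemma trace_sum I (r : seq I) (P : pred I) (f : I -> F) :
  trace (\sum_(i <- r | P i) f i) = \sum_(i <- r | P i) trace (f i).
Proof. exact: (big_morph trace traceD trace0). Qed.

Lemma frobenius_fixed (x : F) : x ^+ 2 = x -> x = (x != 0)%:R.
Proof.
have [-> //|x0] := eqVneq x 0; rewrite expr2 -[RHS]mulr1 => /(mulfI x0) -> //.
Qed.

(** Squaring shifts the terms cyclically, because [x ^+ (2 ^ m) = x]. *)
Lemma trace_frobenius x : trace x ^+ 2 = trace x.
Proof.
rewrite -[(_ ^+ 2)]/(_ ^+ (2 ^ 1)%N) [in LHS]/trace.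
rewrite (big_morph (fun z => z ^+ (2 ^ 1)) (frobenius_iterD 1) (expr0n _ _)) /=.
rewrite /trace; under eq_bigr => i _ do rewrite -exprM -expnD.
have x2m : x ^+ (2 ^ m) = x by rewrite -cardF expf_card.
case: m x2m => [|k] x2m; first by rewrite !big_ord0.
rewrite big_ord_recr [RHS]big_ord_recl /= addn1 x2m addrC; congr (_ + _).
by apply: eq_bigr => i _; rewrite addn1.
Qed.

(** This section derives a contradiction from the assumption [prim_trace1] that
    every generator of the multiplicative group has trace one: the traces of
    all elements are then forced, and they cannot be those of a nonzero additive
    map. *)
Section PrimitiveTrace.

Variable a : F.
Hypothesis (prim_a : (2 ^ m).-1.-primitive_root a).
Hypothesis prim_trace1 : forall b, (2 ^ m).-1.-primitive_root b -> trace b = 1.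
Hypothesis m_gt2 : (2 < m)%N.

Let N := (2 ^ m).-1.

Let N_gt0 : (0 < N)%N.
Proof. exact: prim_order_gt0 prim_a. Qed.

Let N_odd : odd N.
Proof.
have m_gt0 : (0 < m)%N by lia.
by rewrite /N -subn1 oddB ?expn_gt0 // oddX /= orbF gtn_eqF.
Qed.

(** The [l]-th roots of unity sum to zero when [l > 1], hence so does every
    coset of that group, and the trace is additive. *)
Lemma trace_coset_sum l k : prime l -> (l %| N)%N ->
  \sum_(j < l) trace (a ^+ (k + j * (N %/ l))) = 0.
Proof.
move=> l_pr l_N; have l_gt1 := prime_gt1 l_pr.
rewrite -trace_sum.
under eq_bigr => j _ do rewrite exprD mulnC exprM.
rewrite -mulr_sumr; set w := a ^+ (N %/ l).
suff -> : \sum_(j < l) w ^+ j = 0 by rewrite mulr0 trace0.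
have w_l : w ^+ l = 1 by rewrite -exprM divnK // (prim_expr_order prim_a).
have w1 : w - 1 != 0.
  rewrite subr_eq0 -(prim_order_dvd prim_a) gtnNdvd ?divn_gt0 ?prime_gt0 //.
    exact: dvdn_leq.
  by rewrite ltn_Pdiv.
apply: (mulfI w1); rewrite mulr0; move: (subrX1 w l); rewrite w_l subrr => /esym.
by [].
Qed.

(** If [l ^ 2] divides the order of the group, multiplying a generator by an
    [l]-th root of unity gives a generator again, so the coset of [a] would
    contribute [l] ones, an odd number, to a sum that vanishes. *)
Lemma group_order_squarefree l : prime l -> (l %| N)%N -> coprime l (N %/ l).
Proof.
move=> l_pr l_N; rewrite prime_coprime //; apply/negP => l_Nl.
have := trace_coset_sum 1 l_pr l_N.
rewrite (eq_bigr (fun=> 1)) => [|j _].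
  rewrite sumr_const card_ord -(odd_double_half l) (dvdn_odd l_N N_odd) add1n.
  rewrite mulrS -mul2n mulrnA -[1 *+ 2]/(2%:R) pcharf0 // mul0rn addr0 => /eqP.
  by rewrite oner_eq0.
apply: prim_trace1; rewrite prim_root_exp_coprime // -/N.
have := divnK l_N; move: l_Nl; set q := (N %/ l)%N => l_q <-.
have c : coprime (1 + j * q) q by rewrite /coprime gcdnC addnC gcdnMDl gcdn1.
by rewrite coprimeMr c (coprime_dvdr l_q c).
Qed.

(** For non-generators, by strong induction on [gcdn k N], a measure of how far
    [a ^+ k] is from being a generator. If the prime [l] divides this gcd, then in
    the coset of [a ^+ k] under the [l]-th roots of unity all the other elements
    have the same, smaller gcd with [N]. There are [l - 1] of them, an even
    number, and their traces are equal by induction, hence cancel out. *)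
Lemma trace_prim_pow k : trace (a ^+ k) = (coprime k N)%:R.
Proof.
have [g le_g] := ubnP (gcdn k N); elim: g k le_g => // g IH k le_g.
have [k_N|] := boolP (coprime k N).
  by apply: prim_trace1; rewrite prim_root_exp_coprime.
rewrite /coprime => gN1.
have gN_gt0 : (0 < gcdn k N)%N by rewrite gcdn_gt0 N_gt0 orbT.
pose l := pdiv (gcdn k N).
have l_pr : prime l by rewrite pdiv_prime; lia.
have := pdiv_dvd (gcdn k N); rewrite -/l dvdn_gcd => /andP[l_k l_N].
have l_sq := group_order_squarefree l_pr l_N.
have := trace_coset_sum k l_pr l_N.
have l_odd := dvdn_odd l_N N_odd.
have := divnK l_N; move: l_sq; set q := (N %/ l)%N => l_q qlN.
case E : l l_odd => [|l'] //= l'_even.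
rewrite big_ord_recl /= mul0n addn0.
have gq_lt : (gcdn k q < gcdn k N)%N.
  rewrite ltn_neqAle; apply/andP; split.
    apply/eqP => eq_g; have : (l %| gcdn k q)%N by rewrite eq_g dvdn_gcd l_k.
    by apply/negP; rewrite -prime_coprime // (coprime_dvdr (dvdn_gcdr _ _) l_q).
  by rewrite dvdn_leq // dvdn_gcd dvdn_gcdl -qlN dvdn_mulr ?dvdn_gcdr.
rewrite (eq_bigr (fun=> (coprime k q)%:R)) => [|i _].
  rewrite sumr_const card_ord -(odd_double_half l') (negPf l'_even) add0n.
  rewrite -mul2n mulrnA -[_ *+ 2]mulr_natr (pcharf0 char2) mulr0 mul0rn addr0.
  by [].
rewrite /bump leq0n add1n; set j := i.+1.
have j_l : coprime (k + j * q) l.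
  rewrite coprime_sym prime_coprime // (dvdn_addr _ l_k) Gauss_dvdl //.
  by rewrite gtnNdvd // E /j ltnS.
have gE : gcdn (k + j * q) N = gcdn k q.
  by rewrite -qlN Gauss_gcdl // gcdnC addnC gcdnMDl gcdnC.
by rewrite IH /coprime gE // (leq_trans gq_lt).
Qed.

(** Suppose that [N] is composite and let [l] be its least prime divisor. The
    group generated by [c := a ^+ l] has order [N / l], too large to fit in a proper
    subfield, so [c] differs from all its other conjugates [c ^+ (2 ^ i)]. But
    the powers of [c] are not generators, so the power sums of these conjugates all
    vanish: evaluating a polynomial at the [m] conjugates and summing always
    gives zero, even for the one that vanishes at all of them but [c]. *)
Lemma group_order_prime : prime N.
Proof.
apply: contraT => N_comp; pose l := pdiv N; pose q := (N %/ l)%N.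
have N_gt1 : (1 < N)%N.
  have : (2 ^ 3 <= 2 ^ m)%N by rewrite leq_exp2l.
  by rewrite /N; lia.
have l_pr : prime l by rewrite pdiv_prime.
have l_N : (l %| N)%N := pdiv_dvd N.
have qlN : (q * l)%N = N by rewrite divnK.
have l_q : (l <= q)%N.
  rewrite leq_divRL ?prime_gt0 // mulnn leqNgt.
  by apply: contra N_comp => /ltn_pdiv2_prime -> //.
pose c := a ^+ l.
have c_prim : q.-primitive_root c.
  have := exp_prim_root prim_a l; rewrite -/N (_ : gcdn l N = l) //.
  by apply/gcdn_idPl.
have c_trace k : trace (c ^+ k) = 0.
  rewrite -exprM trace_prim_pow; suff /negPf -> : ~~ coprime (l * k) N by [].
  by rewrite coprimeMl negb_and prime_coprime // l_N.
have c_conj i : (0 < i < m)%N -> c ^+ (2 ^ i) != c.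
  case/andP=> i_gt0 i_lt; have i_le := ltnW i_lt.
  rewrite -[X in _ != X]expr1 (eq_prim_root_expr c_prim).
  rewrite eqn_mod_dvd ?expn_gt0 //; apply/negP => q_i.
  have q_mi : (q %| 2 ^ (m - i) - 1)%N.
    have q_odd : odd q by apply: dvdn_odd N_odd; rewrite -qlN dvdn_mulr.
    (* N = 2 ^ i * (2 ^ (m - i) - 1) + (2 ^ i - 1), and q divides N and is odd. *)
    rewrite -(@Gauss_dvdr _ (2 ^ i)) ?coprimeXr ?coprimen2 //.
    rewrite -(dvdn_addl _ q_i) mulnBr -expnD subnKC // muln1.
    rewrite addnBA ?expn_gt0 // subnK ?leq_exp2l //.
    by rewrite subn1 -/N -qlN dvdn_mulr.
  (* Then q + 1 is at most 2 ^ i and 2 ^ (m - i), so its square is at most 2 ^ m,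
     whereas q ^ 2 is at least N = 2 ^ m - 1 because l is at most q. *)
  have le_i : (q.+1 <= 2 ^ i)%N.
    have := dvdn_leq _ q_i; rewrite subn_gt0 -[X in (X < _)%N](expn0 2) ltn_exp2l //.
    by move=> /(_ i_gt0); lia.
  have le_mi : (q.+1 <= 2 ^ (m - i))%N.
    have := dvdn_leq _ q_mi; rewrite subn_gt0 -[X in (X < _)%N](expn0 2) ltn_exp2l //.
    by rewrite subn_gt0 => /(_ i_lt); lia.
  have := leq_mul le_i le_mi; rewrite -expnD subnKC //.
  have : (N <= q * q)%N by rewrite -qlN leq_mul2l l_q orbT.
  have q_gt0 : (0 < q)%N by rewrite (leq_trans _ l_q) ?prime_gt0.
  by rewrite /N mulSn mulnS; lia.
pose Q := \prod_(i < m | (0 < i)%N) ('X - (c ^+ (2 ^ i))%:P).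
have : \sum_(i < m) Q.[c ^+ (2 ^ i)] = 0.
  under eq_bigr => i _ do rewrite horner_coef.
  rewrite exchange_big big1 //= => k _; rewrite -mulr_sumr.
  under eq_bigr => i _ do rewrite exprAC.
  by rewrite -/(trace (c ^+ k)) c_trace mulr0.
have m_gt0 : (0 < m)%N by lia.
rewrite (bigD1 (Ordinal m_gt0)) //= [X in _ + X]big1 => [|i].
  move=> /eqP; rewrite addr0 expr1 horner_prod prodf_seq_eq0 => /hasP[i _ /andP[i_gt0]].
  rewrite hornerXsubC subr_eq0 eq_sym => /eqP e.
  by have := c_conj i; rewrite i_gt0 ltn_ord e eqxx => /(_ isT).
rewrite -val_eqE /= -lt0n => i_gt0.
by rewrite horner_prod (bigD1 i) //= hornerXsubC subrr mul0r.
Qed.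

(** When [N] is prime every element other than 0 and 1 is a generator; two of them,
    whose sum is again neither 0 nor 1, contradict additivity of the trace. *)
Lemma not_all_primitive_trace1 : False.
Proof.
have tr1 x : x != 0 -> x != 1 -> trace x = 1.
  move=> x0 x1; have xN : x ^+ N = 1.
    apply: (mulfI x0); rewrite -exprS prednK ?expn_gt0 // -cardF expf_card mulr1.
    by [].
  case: (prim_rootP prim_a xN) => i xi; rewrite xi trace_prim_pow.
  rewrite [coprime _ _](_ : _ = true) // coprime_sym.
  rewrite prime_coprime ?group_order_prime //.
  apply: contra x1 => N_i; rewrite xi.
  by rewrite -(prim_order_dvd prim_a).
have ex (s : seq F) : (size s < 8)%N -> exists x, x \notin s.
  move=> s8; apply/existsP; apply: contraTT s8; rewrite negb_exists => /forallP sF.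
  rewrite -leqNgt (@leq_trans #|F|) //.
    by rewrite cardF -[8%N]/(2 ^ 3)%N leq_exp2l.
  apply: (leq_trans _ (card_size s)).
  apply: subset_leq_card; apply/fintype.subsetP => x _.
  exact: negbNE (sF x).
have [x] := ex [:: 0; 1] isT; rewrite !inE negb_or => /andP[x0 x1].
have [y] := ex [:: 0; 1; x; x + 1] isT; rewrite !inE !negb_or => /and4P[y0 y1 yx yx1].
have yx' : x + y != 0 by rewrite addr_eq0 oppr_pchar2 // eq_sym.
have yx1' : x + y != 1.
  by apply: contra yx1 => /eqP <-; rewrite addrA addrr_pchar2 // add0r.
have /eqP := traceD x y; rewrite !tr1 // addrr_pchar2 //.
by rewrite oner_eq0.
Qed.

End PrimitiveTrace.

Lemma primitive_root_exists : (0 < m)%N ->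
  exists a : F, (2 ^ m).-1.-primitive_root a.
Proof.
move=> m_gt0; have N_gt0 : (0 < (2 ^ m).-1)%N.
  by rewrite -ltnS prednK ?expn_gt0 // (@ltn_exp2l 2 0).
suff /hasP[a _ prim_a] : has (2 ^ m).-1.-primitive_root (enum (predC1 (0 : F))).
  by exists a.
apply: has_prim_root => //; last 2 first.
- exact: enum_uniq.
- by rewrite -cardE -cardF (cardC1 (0 : F)).
apply/allP => x; rewrite mem_enum inE => x0; apply/unity_rootP.
by apply: (mulfI x0); rewrite -exprS prednK ?expn_gt0 // -cardF expf_card mulr1.
Qed.

Lemma trace_zero_primitive : (2 < m)%N ->
  exists2 a : F, (2 ^ m).-1.-primitive_root a & trace a = 0.
Proof.
move=> m_gt2; have [|a prim_a] := primitive_root_exists; first by lia.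
have [/existsP[b /andP[prim_b /eqP]]|no_b] :=
  boolP [exists b : F, (2 ^ m).-1.-primitive_root b && (trace b == 0)].
  by exists b.
exfalso; apply: (not_all_primitive_trace1 prim_a _ m_gt2) => b prim_b.
rewrite (frobenius_fixed (trace_frobenius b)); case: eqP => // tr_b.
by case/existsP: no_b; exists b; rewrite prim_b tr_b eqxx.
Qed.

(** The coefficients are those of the product of the ['X - a ^+ (2 ^ i)], which is
    invariant under squaring, so has its coefficients in the prime field; its
    coefficient of degree [m - 1] is minus the sum of its roots, the trace. *)
Lemma companion_coefficients (a : F) : (0 < m)%N -> a != 0 ->
  exists c : nat -> bool,
    [/\ c 0%N, c m.-1 = (trace a != 0)
      & a ^+ m = \sum_(i < m) (c i)%:R * a ^+ i].
Proof.
move=> m_gt0 a0; pose s := [seq a ^+ (2 ^ i) | i <- index_iota 0 m].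
have size_s : size s = m by rewrite size_map size_iota subn0.
pose P := \prod_(x <- s) ('X - x%:P).
have size_P : size P = m.+1 by rewrite size_prod_XsubC size_s.
have P_fixed i : P`_i ^+ 2 = P`_i.
  rewrite -(pFrobenius_autE char2) -coef_map; congr (polyseq _)`_i.
  rewrite rmorph_prod /=.
  under eq_bigr => x _ do rewrite rmorphB /= map_polyX map_polyC /=.
  rewrite /P /s !big_map.
  under eq_bigr => j _ do rewrite pFrobenius_autE -exprM mulnC -expnS.
  have : a ^+ (2 ^ m) = a by rewrite -cardF expf_card.
  case: m m_gt0 => // k _ a2k.
  by rewrite big_nat_recr //= big_nat_recl //= a2k expr1 mulrC.
exists (fun i => P`_i != 0); split.
- rewrite coef0_prod_XsubC mulf_neq0 ?signr_eq0 // prodf_seq_neq0.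
  by apply/allP => _ /mapP[i _ ->]; rewrite expf_neq0.
- rewrite -size_s coefPn_prod_XsubC -?lt0n ?size_s // oppr_eq0 big_map.
  by rewrite /trace big_mkord.
- have : P.[a] = 0.
    apply/rootP; rewrite root_prod_XsubC; apply/mapP; exists 0%N => //.
    by rewrite mem_index_iota.
  have lead_P : P`_m = 1.
    by have /monicP := monic_prod_XsubC s xpredT id; rewrite lead_coefE size_P.
  rewrite horner_coef size_P big_ord_recr /= lead_P mul1r => /eqP.
  rewrite addrC addr_eq0 oppr_pchar2 // => /eqP ->.
  by apply: eq_bigr => i _; rewrite -frobenius_fixed.
Qed.

End Trace.

(** * Cycles of the pulse dynamics *)

Local Open Scope nat_scope.

Section Attractors.

Variable V : finType.
Implicit Types (E : digraph V) (x : state V).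

Lemma has_attractor_embedding E (T : eqType) (g : T -> T) (e : T -> state V)
    (c : seq T) :
  injective e -> (forall t, pulse_step E (e t) = e (g t)) ->
  ucycle (frel g) c -> 0 < size c -> has_attractor E (size c).
Proof.
move=> e_inj e_step /andP[cyc_c uniq_c] c_gt0; rewrite /has_attractor c_gt0.
apply/existsP; exists (map_tuple e (in_tuple c)); rewrite /ucycleb /= map_inj_uniq //.
rewrite uniq_c andbT cycle_map; apply: sub_cycle cyc_c => t u /= /eqP <-.
by rewrite e_step.
Qed.

Definition quiet : {set state V} := [set x : state V | #|[set v | x v]| <= 1].

(** Every vertex then has at most one active in-neighbour, and no prime is below 2. *)
Lemma pulse_step_quiet E x : x \in quiet -> pulse_step E x = [ffun=> false].
Proof.
rewrite inE => x_le1; apply/ffunP => v; rewrite !ffunE; apply/negbTE/negP => /prime_gt1.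
rewrite ltnNge (leq_trans _ x_le1) // /active_in big_mkcond -sum1_card.
rewrite [X in _ <= X]big_mkcond; apply: leq_sum => u _; rewrite !inE.
by case: (_ \in _); case: (x u).
Qed.

(** The zero state and the states with exactly one active vertex. *)
Lemma card_quiet : #|V| < #|quiet|.
Proof.
pose e (o : option V) : state V := [ffun v => o == Some v].
have e_inj : injective e.
  move=> [u|] [v|] // /ffunP e_eq.
  - by have := e_eq u; rewrite !ffunE eqxx => /esym/eqP.
  - by have := e_eq u; rewrite !ffunE eqxx.
  - by have := e_eq v; rewrite !ffunE eqxx.
rewrite -card_option -(card_codom e_inj); apply: subset_leq_card.
apply/fintype.subsetP => _ /codomP[p ->]; rewrite inE.
case: p => [u|].
  rewrite -(cards1 u); apply: subset_leq_card; apply/fintype.subsetP => v.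
  by rewrite !inE ffunE => /eqP[->].
by rewrite (_ : [set v | _] = finset.set0) ?cards0 //; apply/setP => v; rewrite !inE ffunE.
Qed.

Lemma fixed_point_in_cycle (T : eqType) (f : T -> T) (c : seq T) (x : T) :
  ucycle (frel f) c -> x \in c -> f x = x -> size c <= 1.
Proof.
move=> uc x_c fx; have [i s def_s] := rot_to x_c.
rewrite -(size_rot i) def_s; move: uc; rewrite -(rot_ucycle i) def_s.
case: s {def_s} => //= y s; rewrite /ucycle /= fx => /andP[/andP[/eqP <-]].
by rewrite inE eqxx.
Qed.

(** The zero state is fixed, so it lies on no longer cycle, and neither do the
    other quiet states, which are mapped to it: such a cycle misses all of
    them. *)
Lemma attractor_period_bound E p : 4 < #|V| ->
  has_attractor E p -> p <= 2 ^ #|V| - #|V| - 1.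
Proof.
move=> V_gt4 /andP[_ /existsP[c uc]]; have [p_le1|p_gt1] := leqP p 1.
  apply: leq_trans p_le1 _; rewrite -addn1 in V_gt4.
  elim: #|V| V_gt4 => // n IH; rewrite leq_eqVlt => /orP[/eqP <- //|/IH].
  by rewrite expnS; lia.
have sub_c : c \subset [predC quiet].
  apply/fintype.subsetP => x x_c; rewrite inE; apply/negP => x_q.
  have zero_c : [ffun=> false] \in (c : seq _).
    by rewrite -(pulse_step_quiet E x_q); apply: mem_fcycle x_c; case/andP: uc.
  have := fixed_point_in_cycle uc zero_c; rewrite size_tuple leqNgt p_gt1.
  move=> H; suff: false by []. apply: H; apply: pulse_step_quiet.
  rewrite inE (_ : [set v | _] = finset.set0) ?cards0 //.
  by apply/setP => v; rewrite !inE ffunE.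
have := subset_leq_card sub_c; have /andP[_ /card_uniqP ->] := uc; rewrite size_tuple.
have := cardC quiet; rewrite card_ffun card_bool; have := card_quiet.
by move=> q_gt <- /leq_trans -> //; rewrite -subnDA addn1 -addnBAC // leq_addl.
Qed.

End Attractors.

(** * Constant vertices *)

Section ConstantOnes.

Variable m : nat.
Variables (D : rel 'I_m) (k : 'I_m -> nat).

(** The three additional vertices form a complete digraph: once all active, each
    sees the two others, and 2 is prime, so they stay active for ever. Those
    with index less than [k v] also feed the vertex [v], which shifts by [k v] the
    number whose primality is tested there. *)
Definition add_ones : digraph 'I_(m + 3) :=
  [set e | match fintype.split e.1, fintype.split e.2 with
           | inl u, inl v => D u v
           | inr j, inl v => j < k v
           | inl _, inr _ => false
           | inr j, inr j' => j != j'
           end].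

Definition with_ones (y : state 'I_m) : state 'I_(m + 3) :=
  [ffun v => if fintype.split v is inl u then y u else true].

Lemma split_lshift (i : 'I_m) : fintype.split (lshift 3 i) = inl i.
Proof. exact: (unsplitK (inl i)). Qed.

Lemma split_rshift (j : 'I_3) : fintype.split (rshift m j) = inr j.
Proof. exact: (unsplitK (inr j)). Qed.

Lemma with_ones_inj : injective with_ones.
Proof.
move=> y z /ffunP yz; apply/ffunP => u; have := yz (lshift 3 u).
by rewrite !ffunE split_lshift.
Qed.

(** Used with [G] a state, to count active in-neighbours, and with [G] constantly 1,
    to count edges. *)
Lemma sum_in_nbrs_register v (G : 'I_(m + 3) -> nat) : k v <= 3 ->
  (forall j, G (rshift m j) = 1) ->
  \sum_(u in in_nbrs add_ones (lshift 3 v)) G u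
    = \sum_(u | D u v) G (lshift 3 u) + k v.
Proof.
move=> k3 G1; rewrite big_split_ord /=; congr (_ + _).
  by apply: eq_bigl => u; rewrite !inE /= !split_lshift.
rewrite (eq_big (fun j : 'I_3 => j < k v) (fun=> 1)) => [|j|j _]; last exact: G1.
  by case: (k v) k3 => [|[|[|[|]]]] //= _; rewrite big_mkcond !big_ord_recl big_ord0.
by rewrite !inE /= split_lshift split_rshift.
Qed.

Lemma sum_in_nbrs_one j (G : 'I_(m + 3) -> nat) :
  (forall j', G (rshift m j') = 1) ->
  \sum_(u in in_nbrs add_ones (rshift m j)) G u = 2.
Proof.
move=> G1; rewrite big_split_ord /= big1 => [|u]; last first.
  by rewrite !inE /= split_lshift split_rshift.
rewrite add0n (eq_big (fun j' : 'I_3 => j' != j) (fun=> 1)) => [|j'|j' _].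
- by rewrite sum1_card cardC1 card_ord.
- by rewrite !inE /= !split_rshift.
- exact: G1.
Qed.

Hypothesis k_le3 : forall v, k v <= 3.

Lemma pulse_step_with_ones y :
  pulse_step add_ones (with_ones y)
    = with_ones [ffun v => prime (active_in [set e | D e.1 e.2] y v + k v)].
Proof.
have ones j : (with_ones y (rshift m j) : nat) = 1 by rewrite ffunE split_rshift.
apply/ffunP => v; rewrite !ffunE -[v]splitK; case: (fintype.split v) => [u|j] /=.
  rewrite split_lshift ffunE /active_in (sum_in_nbrs_register (k_le3 u) ones).
  congr (prime (_ + _)); apply: eq_big => [w|w _]; first by rewrite !inE.
  by rewrite ffunE split_lshift.
by rewrite split_rshift /active_in (sum_in_nbrs_one j ones).
Qed.

Lemma indegree_register v :
  #|in_nbrs add_ones (lshift 3 v)| = #|[set u | D u v]| + k v.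
Proof.
rewrite -sum1_card (sum_in_nbrs_register (G := fun=> 1)) // sum1_card.
by congr (_ + _); apply: eq_card => u; rewrite inE.
Qed.

Lemma indegree_one j : #|in_nbrs add_ones (rshift m j)| = 2.
Proof. by rewrite -sum1_card (sum_in_nbrs_one j (G := fun=> 1)). Qed.

Lemma loopless_add_ones : (forall v, ~~ D v v) -> loopless add_ones.
Proof.
move=> D_irr; apply/forallP => v; rewrite inE /=.
by case: (fintype.split v) => [u|j] //; rewrite negbK.
Qed.

End ConstantOnes.

Lemma card_edges (V : finType) (E : digraph V) : #|E| = \sum_v #|in_nbrs E v|.
Proof.
rewrite -sum1_card (eq_bigl (fun e => (e.1, e.2) \in E)); last by case.
under [RHS]eq_bigr => v _ do rewrite -sum1_card.
rewrite (exchange_big_dep xpredT) //= pair_big_dep /=; apply: eq_bigl => -[u v] /=.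
by rewrite !inE.
Qed.

(** Two vertices, one copying the other and the other negating the first: for
    a bit [x], [x + 1] is prime iff [x = 1], and [x + 3] is prime iff [x = 0]. The
    period is 4. *)
Lemma L_five : 3 <= L 5.
Proof.
pose D : rel 'I_2 := fun u v => u != v.
pose k (v : 'I_2) := if v == ord0 then 1 else 3.
have k3 v : k v <= 3 by rewrite /k; case: ifP.
pose e (b : bool * bool) : state 'I_(2 + 3) :=
  with_ones [ffun v : 'I_2 => if v == ord0 then b.1 else b.2].
have e_inj : injective e.
  move=> [b1 b2] [d1 d2] /with_ones_inj/ffunP bd'.
  have := bd' ord0; rewrite !ffunE /= => ->.
  by have := bd' (lift ord0 ord0); rewrite !ffunE /= => ->.
have e_step b : pulse_step (add_ones D k) (e b) = e (b.2, ~~ b.1).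
  rewrite pulse_step_with_ones //; congr with_ones; apply/ffunP => v; rewrite !ffunE.
  rewrite /active_in big_mkcond /= !big_ord_recl big_ord0 !inE /D /= !ffunE /=.
  by case: v => [[|[|]]] //= v2; case: b => [[] []].
apply: (@leq_trans 4) => //; rewrite -[5]/(2 + 3); apply: L_max; apply/existsP.
exists (add_ones D k).
rewrite loopless_add_ones /=; last by move=> v; rewrite /D eqxx.
pose c := [:: (false, false); (false, true); (true, true); (true, false)].
exact: (has_attractor_embedding (c := c) e_inj e_step).
Qed.

(** * The shift register *)

Section ShiftRegister.

Variables (r : nat) (c : nat -> bool).
Hypothesis c0 : c 0.
Let m := r.+1.

(** A Galois shift register with taps [c]. *)
Definition register_edges : rel 'I_m :=
  fun u v => (u.+1 == v) || ((u == r :> nat) && c v).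

(** Three ones turn a sum of two bits into the negation of their exclusive or,
    as 3 and 5 are prime and 4 is not; a single one copies a single bit. The tap
    [v = 0] has only the last bit to read. *)
Definition register_ones (v : 'I_m) : nat := if (0 < v) && c v then 3 else 1.

Definition register_graph : digraph 'I_(m + 3) := add_ones register_edges register_ones.

Lemma register_ones_le3 v : register_ones v <= 3.
Proof. by rewrite /register_ones; case: ifP. Qed.

Lemma sum_register_edges (G : 'I_m -> nat) (v : 'I_m) :
  \sum_(u | register_edges u v) G u
    = (if v : nat is i.+1 then G (inord i) else 0) + (if c v then G ord_max else 0).
Proof.
rewrite big_mkcond big_ord_recr /= /register_edges /= eqxx /=.
rewrite eq_sym [v == _ :> nat](negbTE _) ?ltn_eqF //=; congr (_ + _).
case: v => -[|i] /= i_m; first by rewrite big1 // => u _; rewrite ltn_eqF.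
rewrite ltnS in i_m.
rewrite (bigD1 (Ordinal i_m)) //= eqxx big1 => [|u u_i].
  by rewrite addn0; congr G; apply: val_inj; rewrite /= inordK // ltnS ltnW.
by rewrite eqSS (ltn_eqF (ltn_ord u)) -[_ == i :> nat]/(u == Ordinal i_m) (negPf u_i).
Qed.

Definition register_step (y : state 'I_m) : state 'I_m :=
  [ffun v : 'I_m => (if v : nat is i.+1 then y (inord i) (+) c v else false)
                     (+) (c v && y ord_max)].

Lemma pulse_step_register y :
  pulse_step register_graph (with_ones y) = with_ones (register_step y).
Proof.
rewrite pulse_step_with_ones; last exact: register_ones_le3.
congr with_ones; apply/ffunP => v; rewrite !ffunE /active_in.
rewrite (eq_bigl (register_edges^~ v)) => [|u]; last by rewrite !inE.
rewrite sum_register_edges /register_ones; case: v => -[|i] i_m /=.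
  by rewrite c0; case: (y _).
by case: (c _); case: (y _); case: (y _).
Qed.

Section Field.

Local Open Scope ring_scope.

Variables (F : finFieldType) (a : F).
Hypotheses (char2 : 2%N \in [pchar F]) (cardF : #|F| = (2 ^ m)%N).
Hypothesis prim_a : (2 ^ m).-1.-primitive_root a.
Hypothesis r_gt0 : (0 < r)%N.
Hypothesis a_m : a ^+ m = \sum_(i < m) (c i)%:R * a ^+ i.

Definition register_value (y : state 'I_m) : F := \sum_(i < m) (y i)%:R * a ^+ i.

Let addb_natr (b b' : bool) : (b (+) b')%:R = b%:R + b'%:R :> F.
Proof. by case: b b' => [] [] /=; rewrite ?addr0 ?add0r // addrr_pchar2. Qed.

Lemma register_valueD (y z : state 'I_m) :
  register_value [ffun i => y i (+) z i] = register_value y + register_value z.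
Proof.
rewrite -big_split; apply: eq_bigr => i _.
by rewrite ffunE addb_natr mulrDl.
Qed.

Definition taps : state 'I_m := [ffun v : 'I_m => (0 < v)%N && c v].

(** Up to a translation, caused by the negations at the positive taps, a step of the
    register is multiplication by [a] in the basis of the powers of [a]. *)
Lemma register_value_step y :
  register_value (register_step y) = a * register_value y + register_value taps.
Proof.
have step_coef (v : 'I_m) : (register_step y v)%:R
    = (if v : nat is i.+1 then (y (inord i))%:R else 0) + (c v)%:R * (y ord_max)%:R
      + (taps v)%:R :> F.
  rewrite !ffunE addb_natr -mulnb natrM; case: v => -[|i] i_m /=; first by rewrite addr0.
  by rewrite addb_natr addrAC.
rewrite /register_value; under eq_bigr => v _ do rewrite step_coef mulrDl.
rewrite big_split; congr (_ + _).
under eq_bigr => v _ do rewrite mulrDl mulrAC.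
rewrite big_split /= -mulr_suml -a_m.
rewrite [in RHS]big_ord_recr /= mulrDr mulrCA -exprS mulrC.
congr (_ + _); rewrite big_ord_recl mul0r add0r mulr_sumr; apply: eq_bigr => i _.
rewrite mulrCA /= /bump leq0n add1n exprS add0n; congr ((y _)%:R * _).
by apply: val_inj; rewrite /= inordK // ltnS ltnW.
Qed.

(** By cardinality it suffices to reach every element: zero, and the powers of the
    generator [a], each from the previous one by a step of the register corrected
    by a translation. *)
Lemma register_value_bij : bijective register_value.
Proof.
have surj x : exists y, register_value y = x.
  have pow k : exists y, register_value y = a ^+ k.
    elim: k => [|k [y yk]].
      exists [ffun i => i == ord0]; rewrite /register_value big_ord_recl big1 => [|i _].
        by rewrite ffunE eqxx addr0 mul1r.
      by rewrite ffunE mul0r.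
    exists [ffun i => register_step y i (+) taps i].
    rewrite register_valueD register_value_step yk -addrA addrr_pchar2 // addr0.
    by rewrite exprS.
  have [->|x0] := eqVneq x 0.
    by exists [ffun=> false]; rewrite /register_value big1 // => i _; rewrite ffunE mul0r.
  have /(prim_rootP prim_a)[i ->] : x ^+ (2 ^ m).-1 = 1; last exact: pow.
  by apply: (mulfI x0); rewrite -exprS prednK ?expn_gt0 // -cardF expf_card mulr1.
have [h hK] := fin_all_exists surj.
apply: (bij_can_bij _ hK); apply: (inj_card_bij (can_inj hK)).
by rewrite card_ffun card_bool card_ord cardF.
Qed.

(** An affine map with linear part [a], different from 1, has a fixed point [w]; measured
    from it, a step is exactly multiplication by [a], which permutes the nonzero
    elements in one cycle. *)
Lemma register_attractor : has_attractor register_graph (2 ^ m - 1).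
Proof.
have [h hK Kh] := register_value_bij.
have a1 : a - 1 != 0.
  rewrite subr_eq0 -[a]expr1 -(prim_order_dvd prim_a) dvdn1.
  have : (2 ^ 2 <= 2 ^ m)%N by rewrite leq_exp2l.
  lia.
pose w := register_value taps / (a - 1).
have aw : a * w = register_value taps + w.
  by rewrite -[in LHS](subrK 1 a) mulrDl mul1r mulrC divfK.
pose e x := with_ones (h (x + w)).
have e_inj : injective e.
  by move=> x z /with_ones_inj/(can_inj Kh)/addIr.
have e_step x : pulse_step register_graph (e x) = e (a * x).
  rewrite pulse_step_register; congr with_ones; apply: (can_inj hK).
  rewrite register_value_step !Kh mulrDr aw -addrA; congr (_ + _).
  by rewrite addrAC addrr_pchar2 // add0r.
have N_gt0 := prim_order_gt0 prim_a.
have iter_a i : iter i (fun x => a * x) 1 = a ^+ i.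
  by elim: i => // i IH; rewrite iterS IH exprS.
rewrite subn1 -(size_traject (fun x => a * x) 1 (2 ^ m).-1).
apply: (has_attractor_embedding e_inj e_step); last by rewrite size_traject.
apply/andP; split.
  rewrite -(prednK N_gt0) /= -/(traject _ _ _) rcons_path fpath_traject.
  rewrite last_traject /= iter_a -exprS prednK //.
  by rewrite (prim_expr_order prim_a).
rewrite -(prednK N_gt0) looping_uniq; apply/negP => /trajectP[i i_lt].
rewrite !iter_a => /eqP; rewrite (eq_prim_root_expr prim_a) !modn_small //.
- by rewrite gtn_eqF.
- by rewrite (ltn_trans i_lt) // prednK.
- by rewrite prednK.
Qed.

End Field.

Section Sparsity.

Hypotheses (r_gt0 : 0 < r) (cr : ~~ c r).

Lemma register_loopless : loopless register_graph.
Proof.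
apply: loopless_add_ones => v; rewrite /register_edges gtn_eqF //=.
by apply: contra cr => /andP[/eqP <-].
Qed.

Lemma register_indegree v :
  #|in_nbrs register_graph (lshift 3 v)| = if (0 < v) && c v then 5 else 2.
Proof.
rewrite indegree_register; last exact: register_ones_le3.
rewrite -sum1_card (eq_bigl (register_edges^~ v)) => [|u]; last by rewrite inE.
rewrite sum_register_edges /register_ones.
by case: v => -[|i] i_m /=; [rewrite c0 | case: (c _)].
Qed.

Lemma register_max_indegree : max_indegree register_graph <= 5.
Proof.
apply/bigmax_leqP => v _; rewrite -[v]splitK; case: (fintype.split v) => [u|j] /=.
  by rewrite register_indegree; case: ifP.
by rewrite indegree_one.
Qed.

(** The complete digraph on the ones has 6 edges, the bits [0] and [r], which are mere
    copies, have in-degree 2, and the others at most 5: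
    [6 + 2 + 2 + 5 * (m - 2) = 5 * m]. *)
Lemma register_card_edges : #|register_graph| <= 5 * m.
Proof.
rewrite card_edges big_split_ord /=.
under [X in _ + X]eq_bigr => j _ do rewrite indegree_one.
under eq_bigr => v _ do rewrite register_indegree.
rewrite sum_nat_const card_ord big_ord_recl /= /m.
case: r r_gt0 cr => // r' _ cr'; rewrite big_ord_recr /= /bump leq0n add1n (negPf cr').
apply: leq_trans (_ : 2 + (\sum_(i < r') 5 + 2) + 6 <= _).
  rewrite leq_add2r leq_add2l leq_add2r; apply: leq_sum => i _.
  by case: ifP.
by rewrite sum_nat_const card_ord; lia.
Qed.

End Sparsity.

End ShiftRegister.

(** * The theorem *)

Lemma sparse_register_graph (m : nat) : 2 < m ->
  exists E : digraph 'I_(m + 3),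
    [/\ loopless E, max_indegree E <= 5, #|E| <= 5 * m
      & has_attractor E (2 ^ m - 1)].
Proof.
case: m => // r m_gt2; have r_gt0 : 0 < r by lia.
have [F char2 cardF] := pPrimePowerField (isT : prime 2) (ltn0Sn r).
have [a prim_a tr_a] := trace_zero_primitive char2 cardF m_gt2.
have a0 : (a != 0)%R.
  by rewrite (prim_root_eq0 prim_a) -lt0n (prim_order_gt0 prim_a).
have [c [c0 cr a_m]] := companion_coefficients char2 cardF (ltn0Sn r) a0.
have {}cr : ~~ c r by rewrite [c r]cr tr_a eqxx.
exists (register_graph r c); split.
- exact: register_loopless.
- exact: register_max_indegree.
- exact: register_card_edges.
- exact: register_attractor char2 cardF prim_a r_gt0 a_m.
Qed.

Lemma L_lower_bound (n : nat) : 5 <= n -> 2 ^ (n - 3) - 1 <= L n.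
Proof.
rewrite leq_eqVlt => /orP[/eqP <-|n_gt5]; first exact: L_five.
rewrite -[n in L n](@subnK 3); last by lia.
have [|E [lE _ _ attE]] := @sparse_register_graph (n - 3); first by lia.
by apply: L_max; apply/existsP; exists E; rewrite lE.
Qed.

Lemma L_upper_bound (n : nat) : 5 <= n -> L n <= 2 ^ n - n - 1.
Proof.
move=> n_ge5; have /existsP[E /andP[_ attE]] := L_attained n.
by have := attractor_period_bound _ attE; rewrite card_ord; apply.
Qed.

(** The constant 16 comes from [2 ^ (n - 4) <= 2 ^ (n - 3) - 1]. *)
Lemma expn2_le_L (n : nat) : 5 <= n -> 2 ^ n <= 16 * L n.
Proof.
move=> n_ge5; apply: leq_trans (leq_mul (leqnn 16) (L_lower_bound n_ge5)).
have -> : 2 ^ n = 8 * 2 ^ (n - 3) by rewrite -[8]/(2 ^ 3) -expnD subnKC //; lia.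
have : 2 ^ 2 <= 2 ^ (n - 3) by rewrite leq_exp2l //; lia.
by lia.
Qed.

Import Num.Theory numFieldNormedType.Exports.
Local Open Scope classical_set_scope.
Local Open Scope nat_scope.

Theorem theorem8 :
  (forall n : nat, 5 <= n ->
     2 ^ (n - 3) - 1 <= L n /\ L n <= 2 ^ n - n - 1)
  /\ (forall R : realType,
        ((fun n : nat => (L n)%:R : R) =Theta_\oo (fun n : nat => 2 ^+ n : R))%R)
  /\ (forall n : nat, 6 <= n ->
        exists E : digraph 'I_n,
          [/\ loopless E, max_indegree E <= 5, #|E| <= 5 * n - 15
            & has_attractor E (2 ^ (n - 3) - 1)]).
Proof.
split; last split.
- by move=> n n_ge5; split; [exact: L_lower_bound | exact: L_upper_bound].
- move=> R; rewrite eqThetaE qualifE; apply/asboolP.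
  exists (16%:R^-1, 1)%R => /=; first by rewrite invr_gt0 ltr0n ltr01.
  near=> n; have n_ge5 : 5 <= n by near: n; exact: nbhs_infty_ge.
  rewrite -natrX !normr_nat mul1r ler_nat ler_pdivrMl ?ltr0n // -natrM ler_nat.
  split; first exact: expn2_le_L.
  by apply: leq_trans (L_upper_bound n_ge5) _; rewrite -subnDA leq_subr.
- move=> n n_ge6; have -> : 5 * n - 15 = 5 * (n - 3) by lia.
  have := @sparse_register_graph (n - 3); rewrite subnK; last by lia.
  by apply; lia.
Unshelve. all: by end_near.
Qed.
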